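(* Let $G$ be a distance-regular graph of valency $d$ and diameter $D\ge1$, with intersection numbers $b_i,c_i,a_i$. For every root $a\in V(G)$, writing $f_i=\mathbf 1_{S_i(a)}$ for the indicator vector of the sphere of radius $i$ at $a$, $$P_a=\mathbb R[B]\mathbf 1=\operatorname{span}\{f_1,\ldots,f_D\},\qquad \mathcal B_a|_{P_a}=\operatorname{End}(P_a)\cong M_D(\mathbb R).$$ On this module, for $1\le i\le D$, $$Bf_i=b_{i-1}f_{i-1}+a_if_i+c_{i+1}f_{i+1},\qquad E=\frac{bb^{\mathsf T}}{d},$$ where terms involving $f_j$ with $j$ outside $1\le j\le D$ are omitted.
   Context: All graphs are finite and simple; all vector spaces and algebras are over $\mathbb R$. For a distance-regular graph (connected by convention), a vertex at distance $i$ from a root has $b_i,c_i,a_i$ neighbours at distances $i+1,i-1,i$ from the root respectively. For a connected regular graph $G$ with at least two vertices and $a\in V(G)$: $B=A(G-a)$ is the adjacency matrix of the vertex-deleted graph, $b=\mathbf 1_{N(a)}$ is the indicator vector of the neighbourhood of $a$ in $\mathbb R^{V(G)\setminus\{a\}}$, $E$ is the diagonal matrix with diagonal $\mathbf 1_{N(a)}$, $\mathbf 1$ is the all-ones vector on $V(G)\setminus\{a\}$, $\mathcal B_a=\langle I,B,E\rangle$ is the real unital algebra generated by $B$ and $E$, and $P_a=\mathcal B_a\mathbf 1$. $\mathcal B_a|_{P_a}$ denotes the algebra of restrictions to $P_a$ of elements of $\mathcal B_a$. The formula for $E$ is an equality of operators on $P_a$. *)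

(* Defs.v *)
From HB Require Import structures.
From mathcomp Require Import all_boot all_order all_algebra all_field.
From mathcomp Require Import reals.

Set Implicit Arguments.
Unset Strict Implicit.
Unset Printing Implicit Defensive.

Import GRing.Theory.

Local Open Scope ring_scope.

(* A finite simple graph is a symmetric irreflexive [e : rel T], [T : finType]. *)

Section Graphs.

Variables (T : finType) (e : rel T).

Definition walk (k : nat) (x y : T) : bool :=
  [exists p : k.-tuple T, path e x p && (last x p == y)].

(* The length of a shortest walk; [#|T|] when there is none, which does not
   happen in a connected graph. *)
Definition gdist (x y : T) : nat := find (fun k => walk k x y) (iota 0 #|T|).

Definition diameter : nat := \max_(x : T) \max_(y : T) gdist x y.

(* [ib], [ic], [ia] are the sequences b_i, c_i, a_i; only their values at
   0 <= i <= D are constrained. *)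
Record distance_regular (d D : nat) (ib ic ia : nat -> nat) : Prop :=
  DistanceRegular {
    dr_sym : symmetric e;
    dr_irr : irreflexive e;
    dr_conn : forall x y, connect e x y;
    dr_val : forall x, #|[set z | e x z]| = d;
    dr_diam : diameter = D;
    dr_b : forall r x,
      #|[set z | e x z & gdist r z == (gdist r x).+1]| = ib (gdist r x);
    dr_c : forall r x,
      #|[set z | e x z & (gdist r z).+1 == gdist r x]| = ic (gdist r x);
    dr_a : forall r x,
      #|[set z | e x z & gdist r z == gdist r x]| = ia (gdist r x)
  }.

End Graphs.

Section Algebras.

Variable R : realType.

(* The unital subalgebra of ['M_n] generated by [s].  [agenv] needs a nonzero
   ambient ring; the zero ring ['M_0] is its own only subspace. *)
Definition gen_alg (n : nat) : seq 'M[R]_n -> {vspace 'M[R]_n} :=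
  match n with
  | 0 => fun=> fullv
  | m.+1 => fun s => agenv <<s>>%VS
  end.

Lemma gen_alg1 n (s : seq 'M[R]_n) : 1%:M \in gen_alg s.
Proof.
case: n s => [|n] s /=; first exact: memvf.
by rewrite memvE; apply: sub1_agenv.
Qed.

Lemma gen_alg_gen n (s : seq 'M[R]_n) X : X \in s -> X \in gen_alg s.
Proof.
case: n s X => [|n] s X /= sX; first exact: memvf.
exact: (subvP (sub_agenv _)) (memv_span sX).
Qed.

Lemma gen_algM n (s : seq 'M[R]_n) X Y :
  X \in gen_alg s -> Y \in gen_alg s -> X *m Y \in gen_alg s.
Proof.
case: n s X Y => [|n] s X Y /= AX AY; first exact: memvf.
by rewrite -[agenv _]agenvM; apply: memv_mul.
Qed.

Lemma gen_alg_min n (s : seq 'M[R]_n) (U : {vspace 'M[R]_n}) :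
    1%:M \in U -> {in U &, forall X Y, X *m Y \in U} -> {subset s <= U} ->
  (gen_alg s <= U)%VS.
Proof.
case: n s U => [|n] s U U1 UM sU /=.
  by apply/subvP => X _; rewrite (_ : X = 0) ?mem0v //; apply/matrixP => - [].
apply: agenv_sub_modl; first by rewrite -memvE.
apply/prodvP => X Y sX UY; apply: UM => //.
by apply: (subvP _ _ sX); apply/span_subvP.
Qed.

Definition alg_mod (n : nat) (A : {vspace 'M[R]_n}) (v : 'cV[R]_n) :
    {vspace 'cV[R]_n} :=
  (linfun (mulmxr v) @: A)%VS.

Lemma alg_modP n (A : {vspace 'M[R]_n}) (v w : 'cV[R]_n) :
  reflect (exists2 X, X \in A & w = X *m v) (w \in alg_mod A v).
Proof.
by apply: (iffP memv_imgP) => -[X AX ->]; exists X; rewrite ?lfunE.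
Qed.

(* The restriction of [X] to [P].  The projection [vsproj P] is only there for
   typing: see [restr_lfunE]. *)
Definition restr_lfun (n : nat) (P : {vspace 'cV[R]_n}) (X : 'M[R]_n) :
    'End(subvs_of P) :=
  linfun (vsproj P \o (mulmx X \o vsval)).

Lemma restr_lfunE n (P : {vspace 'cV[R]_n}) X (u : subvs_of P) :
    {in P, forall v, X *m v \in P} ->
  vsval (restr_lfun P X u) = X *m vsval u.
Proof. by move=> PX; rewrite lfunE /= vsprojK ?PX ?subvsP. Qed.

Lemma gen_alg_stable n (s : seq 'M[R]_n) v X :
    X \in gen_alg s ->
  {in alg_mod (gen_alg s) v, forall w, X *m w \in alg_mod (gen_alg s) v}.
Proof.
move=> AX w /alg_modP[Y AY ->]; apply/alg_modP.
by exists (X *m Y); rewrite ?mulmxA ?gen_algM.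
Qed.

Fact restr_lfun_is_linear n (P : {vspace 'cV[R]_n}) : linear (restr_lfun P).
Proof.
move=> c X Y; apply/lfunP => u.
by rewrite !lfunE /= !lfunE /= lfunE /= mulmxDl -scalemxAl linearP.
Qed.

HB.instance Definition _ n (P : {vspace 'cV[R]_n}) :=
  GRing.isLinear.Build R 'M[R]_n 'End(subvs_of P) _ (restr_lfun P)
    (restr_lfun_is_linear P).

Definition restr_alg (n : nat) (A : {vspace 'M[R]_n}) (P : {vspace 'cV[R]_n}) :
    {vspace 'End(subvs_of P)} :=
  (linfun (restr_lfun P) @: A)%VS.

Definition End_iso_mx (n D : nat) (P : {vspace 'cV[R]_n}) : Prop :=
  exists psi : {linear 'End(subvs_of P) -> 'M[R]_D},
    [/\ bijective psi, psi \1%VF = 1%:M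
      & forall g h, psi (g \o h)%VF = psi g *m psi h].

End Algebras.

Section Deleted.

Variables (R : realType) (T : finType) (e : rel T) (a : T).

Definition dvertex : finType := {x : T | x != a}.

(* Matrices are indexed by ['I_n]: [dvtx] is the enumeration of V(G) \ {a}. *)
Definition dvtx (i : 'I_#|dvertex|) : T := val (enum_val i).

Definition Bmx : 'M[R]_#|dvertex| := \matrix_(i, j) (e (dvtx i) (dvtx j))%:R.

Definition bvec : 'cV[R]_#|dvertex| := \col_i (e a (dvtx i))%:R.

Definition Emx : 'M[R]_#|dvertex| := diag_mx bvec^T.

Definition onesv : 'cV[R]_#|dvertex| := const_mx 1.

Definition Balg : {vspace 'M[R]_#|dvertex|} := gen_alg [:: Bmx; Emx].

Definition Pmod : {vspace 'cV[R]_#|dvertex|} := alg_mod Balg onesv.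

Definition fvec (k : nat) : 'cV[R]_#|dvertex| :=
  \col_i (gdist e a (dvtx i) == k)%:R.

End Deleted.

(* Main.v *)
Require Import Defs.
From mathcomp Require Import all_boot all_order all_algebra all_field.
From mathcomp Require Import reals zify.

(** The spheres around the root decide everything.  Counting the neighbours of a
    vertex at each distance from [a] gives the three-term formula [Bmx_fvec], and
    [E] kills every [f i] except [f 1 = b], which it fixes.  So the span [F] of
    [f 1, ..., f D] is stable under [B] and [E]; it contains the all-ones vector,
    which is the sum of the [f i].

    For the reverse inclusion, read the three-term formula as a recursion: since
    [c_(i+1)] is nonzero, it expresses [f (i+1)] through [B *m f i], [f i] and
    [f (i-1)], so a [B]-stable space containing [f 1] contains [F]
    ([span_fvec_min]).  In [R[B]1] the vector [f 1] is found as [d 1 - B 1], because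
    only the neighbours of the root have lost a neighbour by its deletion.
    Hence [R[B]1 = P_a = F]; the same recursion shows that [b = f 1] is a cyclic
    vector of [F] as well.

    The [f i] are nonzero (every sphere of radius at most [D] is inhabited, because
    [b_i] is positive for [i < D]) and pairwise orthogonal, so [F] has dimension [D]
    and the formula for [E] can be checked on them: both sides send [f 1 = b] to
    itself, as [b^T b = d], and annihilate the other [f i].

    Finally [E] acts on [F] as a multiple of the rank-one operator [b b^T].  For
    vectors [p = Y b] and [q = Z b] of [F] with [Y], [Z] in the algebra, the element
    [Y (d E) Z^T] acts as [p q^T]; the algebra is closed under transposition because
    its generators are symmetric.  So all rank-one operators [p q^T] with [p], [q]
    in [F] are available, and since [F] has an orthogonal basis they span [End(F)]
    ([restr_alg_full]). *)

Set Implicit Arguments.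
Unset Strict Implicit.
Unset Printing Implicit Defensive.

Import GRing.Theory Num.Theory passmx.

Local Open Scope ring_scope.

(** * Distances in a connected graph *)

Section Distance.

Variables (T : finType) (e : rel T).
Implicit Types x y z : T.
Local Notation dist := (gdist e).

Lemma walkP k x y :
  reflect (exists p, [/\ size p = k, path e x p & last x p = y])
          (walk e k x y).
Proof.
apply: (iffP existsP) => [[p /andP[ep /eqP <-]] | [p [<- ep <-]]].
  by exists p; rewrite size_tuple.
by exists (in_tuple p); rewrite /= ep eqxx.
Qed.

Lemma walk0 x y : walk e 0 x y = (x == y).
Proof.
apply/walkP/eqP => [[p [/eqP]] | <-]; last by exists [::].
by rewrite size_eq0 => /eqP->.
Qed.

Lemma walkS k x y :
  reflect (exists2 z, walk e k x z & e z y) (walk e k.+1 x y).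
Proof.
apply: (iffP (walkP _ _ _)) => [[p [sp ep py]] | [z /walkP[p [sp ep pz]] ezy]].
  case/lastP: p => [//|p w] in sp ep py *.
  move: sp ep py; rewrite size_rcons rcons_path last_rcons => -[sp].
  by case/andP=> ep ew <-; exists (last x p) => //; apply/walkP; exists p.
by exists (rcons p y); rewrite size_rcons sp rcons_path ep pz last_rcons.
Qed.

Lemma gdist_le k x y : walk e k x y -> (dist x y <= k)%N.
Proof.
move=> wk; case: (ltnP k #|T|) => [ltk | leTk]; last first.
  apply: leq_trans leTk.
  by rewrite /gdist -[#|T| in X in (_ <= X)%N](size_iota 0) find_size.
rewrite leqNgt; apply/negP => /(before_find 0%N).
by rewrite nth_iota // add0n wk.
Qed.

(** A shortest path repeats no vertex, so its length is among the lengths below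
    [#|T|] that [gdist] searches. *)
Lemma walk_gdist x y : connect e x y -> walk e (dist x y) x y.
Proof.
case/connectP => p0 ep0 ->; case/shortenP: ep0 => p ep up _.
have ltp : (size p < #|T|)%N.
  by rewrite -[(size p).+1]/(size (x :: p)) -(card_uniqP up) max_card.
have hasp : has (fun k => walk e k x (last x p)) (iota 0 #|T|).
  apply/hasP; exists (size p); first by rewrite mem_iota.
  by apply/walkP; exists p.
have := nth_find 0%N hasp; rewrite nth_iota ?add0n //.
by rewrite -[X in (_ < X)%N](size_iota 0) -has_find.
Qed.

Lemma gdistxx x : dist x x = 0%N.
Proof. by apply/eqP; rewrite -leqn0 gdist_le // walk0. Qed.

Hypothesis conn : forall x y, connect e x y.

Lemma gdist_eq0 x y : (dist x y == 0)%N = (x == y).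
Proof.
apply/eqP/eqP => [d0 | <-]; last exact: gdistxx.
by apply/eqP; rewrite -walk0 -d0 walk_gdist.
Qed.

Lemma gdist_edge x y z : e y z -> (dist x z <= (dist x y).+1)%N.
Proof. by move=> eyz; apply/gdist_le/walkS; exists y; rewrite ?walk_gdist. Qed.

Lemma gdist_pred x y k :
  dist x y = k.+1 -> exists2 z, e z y & dist x z = k.
Proof.
move=> dk; have := walk_gdist (conn x y); rewrite dk => /walkS[z wz ezy].
exists z => //; apply/eqP; rewrite eqn_leq gdist_le //=.
by rewrite -ltnS -dk gdist_edge.
Qed.

(** A geodesic from [x] to [y] meets every sphere around [x] of smaller radius. *)
Lemma gdist_interp x y i : (i <= dist x y)%N -> exists z, dist x z = i.
Proof.
move: {2}(dist x y) (erefl (dist x y)) => k; elim: k y => [|k IHk] y dk.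
  by rewrite dk leqn0 => /eqP->; exists x; rewrite gdistxx.
rewrite leq_eqVlt => /predU1P[->|]; first by exists y.
by case: (gdist_pred dk) => z _ dz; rewrite dk ltnS -dz => /IHk; apply.
Qed.

Lemma gdist_diameter x y : (dist x y <= diameter e)%N.
Proof. exact: leq_trans (leq_bigmax y) (leq_bigmax x). Qed.

Lemma diameter_witness (a : T) : exists x y, dist x y = diameter e.
Proof.
have T0 : (0 < #|T|)%N by apply/card_gt0P; exists a.
case: (eq_bigmax (fun x => \max_y dist x y) T0) => x dx.
case: (eq_bigmax (dist x) T0) => y dy.
by exists x, y; rewrite -dy -dx.
Qed.

End Distance.

(** * Spheres of a distance-regular graph *)

Section DistanceRegular.

Variables (T : finType) (e : rel T) (d D : nat) (ib ic ia : nat -> nat).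
Hypothesis hG : distance_regular e d D ib ic ia.
Local Notation dist := (gdist e).

(** A geodesic realizing the diameter passes from the sphere of radius [i] to the
    next one; the number [b_i] does not depend on the root, so one such geodesic is
    enough. *)
Lemma ib_gt0 i : (i < D)%N -> (0 < ib i)%N.
Proof.
rewrite -(dr_diam hG) => ltiD.
have [a _ | T0] := pickP T; last first.
  by move: ltiD; rewrite /diameter big_pred0.
have [r [y dy]] := diameter_witness e a.
move: ltiD; rewrite -dy => /(gdist_interp (dr_conn hG))[w dw].
have [z ezw dz] := gdist_pred (dr_conn hG) dw.
by rewrite -dz -(dr_b hG); apply/card_gt0P; exists w; rewrite inE ezw dw dz /=.
Qed.

(** A priori the diameter is attained from some root only, but a positive [b_i] lets
    every root step from each sphere to the next. *)
Lemma sphere_nonempty r i : (i <= D)%N -> exists x, dist r x = i.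
Proof.
elim: i => [|i IHi] leiD; first by exists r; rewrite gdistxx.
have [x dx] := IHi (ltnW leiD); have := ib_gt0 leiD.
rewrite -dx -(dr_b hG r) => /card_gt0P[z].
by rewrite inE => /andP[_ /eqP]; exists z.
Qed.

Lemma ic_gt0 i : (1 <= i <= D)%N -> (0 < ic i)%N.
Proof.
case/andP; case: i => // i _ leiD.
have [a _ | T0] := pickP T; last first.
  by move: leiD; rewrite -(dr_diam hG) /diameter big_pred0.
have [y dy] := sphere_nonempty a leiD.
have [z ezy dz] := gdist_pred (dr_conn hG) dy.
rewrite -dy -(dr_c hG); apply/card_gt0P; exists z.
by rewrite inE (dr_sym hG) ezy dz dy /=.
Qed.

(** The three intersection numbers seen from the target sphere: the radius [i] is
    fixed and the vertex [x] varies, as in a coordinate of [B *m f i]. *)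
Lemma card_nbrs_at r x i :
  #|[set z | e x z & dist r z == i]| =
  if i == (dist r x).+1 then ib i.-1 else
  if i == dist r x then ia i else
  if i.+1 == dist r x then ic i.+1 else 0%N.
Proof.
case: eqP => [-> | ni1]; first exact: (dr_b hG).
case: eqP => [-> | ni2]; first exact: (dr_a hG).
case: eqP => [di | ni3].
  by rewrite di -(dr_c hG); apply: eq_card => z; rewrite !inE -di eqSS.
apply: eq_card0 => z; rewrite !inE; apply/negP => /andP[exz /eqP dz].
have := gdist_edge (dr_conn hG) r exz; rewrite (dr_sym hG) in exz.
by have := gdist_edge (dr_conn hG) r exz; rewrite dz; lia.
Qed.

End DistanceRegular.

(** * Cyclic modules of a generated matrix algebra *)

Section Modules.

Variables (R : realType) (n : nat).
Implicit Types (s : seq 'M[R]_n) (X Y : 'M[R]_n) (u v w : 'cV[R]_n).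
Implicit Types (fs : seq 'cV[R]_n) (U : {vspace 'cV[R]_n}).

Lemma span_stable X fs U :
  {in fs, forall v, X *m v \in U} -> {in <<fs>>%VS, forall v, X *m v \in U}.
Proof.
move=> XU v; suff /subvP H : (<<fs>> <= linfun (mulmx X) @^-1: U)%VS.
  by move=> /H; rewrite -memv_preim lfunE.
by apply/span_subvP => w /XU; rewrite -memv_preim lfunE.
Qed.

Lemma alg_mod_gen s v : v \in alg_mod (gen_alg s) v.
Proof. by apply/alg_modP; exists 1%:M; rewrite ?gen_alg1 ?mul1mx. Qed.

(** The matrices sending [v] into [U] form a space containing the identity and
    closed under left multiplication by the generators, hence containing the
    algebra. *)
Lemma alg_mod_min s v U :
    v \in U -> {in s, forall X, {in U, forall w, X *m w \in U}} ->
  (alg_mod (gen_alg s) v <= U)%VS.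
Proof.
case: n s v U => [|m] s v U Uv sU.
  by apply/subvP => w _; rewrite (_ : w = 0) ?mem0v //; apply/matrixP => -[].
apply/subvP => _ /alg_modP[X AX ->].
have /subvP/(_ X AX) : (gen_alg s <= linfun (mulmxr v) @^-1: U)%VS.
  rewrite /gen_alg; apply: agenv_sub_modl.
    by rewrite -memvE -memv_preim lfunE /= mul1mx.
  apply/prodvP => Y Z sY; rewrite -!memv_preim !lfunE /= => UZ.
  rewrite -[Y * Z]/(Y *m Z) -mulmxA.
  suff /subvP/(_ Y sY) : (<<s>> <= linfun (mulmxr (Z *m v)) @^-1: U)%VS.
    by rewrite -memv_preim lfunE.
  by apply/span_subvP => X0 sX0; rewrite -memv_preim lfunE /= sU.
by rewrite -memv_preim lfunE.
Qed.

Lemma gen_alg_trmx s :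
    {in s, forall X, X^T = X} -> {in gen_alg s, forall X, X^T \in gen_alg s}.
Proof.
move=> sT X; suff /subvP H : (gen_alg s <= linfun trmx @^-1: gen_alg s)%VS.
  by move=> /H; rewrite -memv_preim lfunE.
apply: gen_alg_min => [|Y Z|Y sY]; rewrite -!memv_preim !lfunE /=.
- by rewrite trmx1 gen_alg1.
- by rewrite trmx_mul => AY AZ; apply: gen_algM.
- by rewrite sT // gen_alg_gen.
Qed.

Definition dotv u v : R := (u^T *m v) 0 0.

Lemma dotvE u v : dotv u v = \sum_i u i 0 * v i 0.
Proof. by rewrite /dotv mxE; apply: eq_bigr => i _; rewrite mxE. Qed.

Lemma trmx_mul_dotv u v : u^T *m v = (dotv u v)%:M.
Proof. exact: mx11_scalar. Qed.

Lemma dotvv_eq0 u : (dotv u u == 0) = (u == 0).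
Proof.
rewrite dotvE; apply/eqP/eqP => [/psumr_eq0P u0 | ->]; last first.
  by rewrite big1 // => i _; rewrite mxE mul0r.
apply/colP => i; rewrite mxE; apply/eqP; rewrite -[_ == 0]orbb -mulf_eq0.
by apply/eqP/u0 => [j _|//]; rewrite -expr2 sqr_ge0.
Qed.

Definition orthogonal_family fs :=
  [/\ uniq fs, 0 \notin fs & {in fs &, forall u v, u != v -> dotv u v = 0}].

(** Orthogonal nonzero vectors are linearly independent: the product of a vanishing
    combination with one of them isolates its coefficient. *)
Lemma orthogonal_dim fs : orthogonal_family fs -> \dim <<fs>> = size fs.
Proof.
case=> ufs nz0 orth; apply/eqP; change (free (in_tuple fs)).
have fsi (j : 'I_(size fs)) : fs`_j \in fs by exact: mem_nth.
apply/freeP => k k0 i.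
have : dotv fs`_i (\sum_(j < size fs) k j *: fs`_j) = 0.
  by rewrite k0 /dotv mulmx0 mxE.
rewrite /dotv mulmx_sumr summxE (bigD1 i) //= big1 ?addr0 => [|j ij].
  rewrite -scalemxAr mxE => /eqP; rewrite mulf_eq0 => /predU1P[//|].
  by rewrite dotvv_eq0 => /eqP fi0; rewrite -fi0 fsi in nz0.
rewrite -scalemxAr mxE [X in _ * X]orth ?mulr0 ?fsi //.
by rewrite nth_uniq // eq_sym.
Qed.

(** A transpose-closed algebra that has a cyclic vector [w] and contains an element
    acting as [w w^T] contains, up to its action on the module, every [p q^T] with
    [p], [q] in the module.  An endomorphism [g] is then the sum over the orthogonal
    basis [fs] of the operators [g(u) u^T / (u . u)]. *)
Lemma restr_alg_full s v w X0 fs (A := gen_alg s) (P := alg_mod A v) :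
    {in s, forall X, X^T = X} ->
    alg_mod A w = P ->
    X0 \in A -> {in P, forall u, X0 *m u = w *m w^T *m u} ->
    orthogonal_family fs -> P = <<fs>>%VS ->
  restr_alg A P = fullv.
Proof.
move=> sT wP AX0 X0E [ufs nz0 orth] Pfs.
have fsP u : u \in fs -> u \in P by rewrite Pfs; apply: memv_span.
have stabP X : X \in A -> {in P, forall u, X *m u \in P}.
  exact: gen_alg_stable.
apply/vspaceP => g; rewrite memvf.
have rank1 p q : p \in P -> q \in P ->
    restr_lfun P (p *m q^T) \in restr_alg A P.
  rewrite -{1 2}wP => /alg_modP[Y AY ->] /alg_modP[Z AZ ->].
  have AZT : Z^T \in A by apply: gen_alg_trmx.
  have AX : Y *m X0 *m Z^T \in A by rewrite !gen_algM.
  apply/memv_imgP; exists (Y *m X0 *m Z^T); rewrite // lfunE.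
  apply/lfunP => u; rewrite !lfunE /=; congr (vsproj P _).
  by rewrite -!mulmxA X0E ?stabP ?subvsP // trmx_mul !mulmxA.
pose gv u := vsval (g (vsproj P u)).
pose M := \sum_(u <- fs) (dotv u u)^-1 *: (gv u *m u^T).
suff -> : g = restr_lfun P M.
  suff : M \in (linfun (restr_lfun P) @^-1: restr_alg A P)%VS.
    by rewrite -memv_preim lfunE.
  rewrite /M big_seq memv_suml // => u /fsP Pu.
  by apply: memvZ; rewrite -memv_preim lfunE rank1 ?subvsP.
(* [h] extends [g] to the whole space, where agreement on a span is available *)
pose h : 'End('cV[R]_n) :=
  (linfun (vsval : subvs_of P -> _) \o (g \o linfun (vsproj P)))%VF.
have hE u : h u = gv u by rewrite !comp_lfunE !lfunE.
have hM : {in P, h =1 linfun (mulmx M)}.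
  rewrite Pfs; apply: (span_lfunP _ _ _).2 => u fsu.
  rewrite hE lfunE /= mulmx_suml.
  rewrite (bigD1_seq u) //= big_seq_cond big1 ?addr0 => [|y /andP[fsy yu]].
    rewrite -scalemxAl -mulmxA trmx_mul_dotv mul_mx_scalar scalerA.
    by rewrite mulVf ?scale1r // dotvv_eq0; apply: contraNneq nz0 => <-.
  rewrite -scalemxAl -mulmxA trmx_mul_dotv (orth y u) //.
  by rewrite mul_mx_scalar scale0r scaler0.
apply/lfunP => x; rewrite lfunE /=.
have -> : M *m vsval x = vsval (g x).
  by have := hM _ (subvsP x); rewrite hE /gv vsvalK lfunE.
by rewrite vsvalK.
Qed.

(** [mxof] represents endomorphisms on row vectors and so reverses composition;
    the transpose restores the order. *)
Lemma End_iso_mx_dim (D : nat) U : \dim U = D -> End_iso_mx D U.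
Proof.
move=> dU; have {dU} <- : \dim {:subvs_of U} = D by rewrite -dU dimvf.
set X := vbasis {:subvs_of U}; have bX : basis_of fullv X := vbasisP _.
exists (trmx \o mxof X X); split => [||g h] /=.
- apply: bij_comp; first exact: (Bijective (@trmxK _ _ _) (@trmxK _ _ _)).
  exact: (Bijective (mxofK bX bX) (hommxK bX bX)).
- by rewrite mxof1 ?trmx1 ?(basis_free bX).
- by rewrite (mxof_comp _ _ bX) trmx_mul.
Qed.

End Modules.

(** * The vertex-deleted graph *)

Section DeletedGraph.

Variables (R : realType) (T : finType) (e : rel T).
Variables (d D : nat) (ib ic ia : nat -> nat).
Hypotheses (hG : distance_regular e d D ib ic ia) (hD : (1 <= D)%N).
Variable a : T.
Local Notation dist := (gdist e).
Local Notation B := (Bmx R e a).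
Local Notation E := (Emx R e a).
Local Notation b := (bvec R e a).
Local Notation f := (fvec R e a).
Local Notation J := (onesv R a).
Local Notation fs := [seq f i | i <- iota 1 D].

Lemma sum_dvtx (F : T -> R) :
  \sum_(i < #|dvertex a|) F (dvtx i) = \sum_(z | z != a) F z.
Proof.
rewrite (big_sub [pred z | z != a]).
by rewrite -(big_enum_val (A := dvertex a) (fun z => F (val z))).
Qed.

Lemma sum_natb (P Q : pred T) :
  \sum_(z | P z) (Q z)%:R = #|[set z | P z & Q z]|%:R :> R.
Proof.
rewrite -natr_sum big_mkcond /= -sum1dep_card [in RHS]big_mkcond /=.
by congr _%:R; apply: eq_bigr => z _; case: (P z); case: (Q z).
Qed.

Lemma dvtx_neq (i : 'I_#|dvertex a|) : dvtx i != a.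
Proof. exact: (valP (enum_val i)). Qed.

Lemma dvtx_surj x : x != a -> exists i : 'I_#|dvertex a|, dvtx i = x.
Proof.
move=> xa; exists (enum_rank (exist _ x xa : dvertex a)).
by rewrite /dvtx enum_rankK.
Qed.

Lemma gdist_dvtx_gt0 (i : 'I_#|dvertex a|) : (0 < dist a (dvtx i))%N.
Proof. by rewrite lt0n (gdist_eq0 (dr_conn hG)) eq_sym dvtx_neq. Qed.

Lemma gdist_dvtx_le (i : 'I_#|dvertex a|) : (dist a (dvtx i) <= D)%N.
Proof. by rewrite -(dr_diam hG) gdist_diameter. Qed.

Lemma bvec_fvec : b = f 1.
Proof.
apply/colP => i; rewrite !mxE; congr (nat_of_bool _)%:R.
apply/idP/eqP => [eai | /(gdist_pred (dr_conn hG))[z + /eqP]].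
  apply/eqP; rewrite eqn_leq gdist_dvtx_gt0 andbT.
  by have := gdist_edge (dr_conn hG) a eai; rewrite gdistxx.
by rewrite (gdist_eq0 (dr_conn hG)) => ez /eqP az; rewrite -az in ez.
Qed.

(** Row sums: a vertex keeps its [d] neighbours, except that the neighbours of [a]
    lose [a]. *)
Lemma Bmx_ones : B *m J = d%:R *: J - f 1.
Proof.
rewrite -bvec_fvec; apply/colP => i; rewrite !mxE mulr1.
under eq_bigr do rewrite !mxE mulr1.
rewrite (sum_dvtx (fun z => (e (dvtx i) z)%:R)).
have : \sum_z (e (dvtx i) z)%:R = d%:R :> R.
  by rewrite sum_natb -(dr_val hG (dvtx i)).
by rewrite (bigD1 a) //= => <-; rewrite (dr_sym hG a) addrC addKr.
Qed.

(** The coordinate at [x] counts the neighbours of [x] at distance [i] from [a];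
    as [i] is positive, none of them is the deleted vertex. *)
Lemma Bmx_fvec i : (1 <= i <= D)%N ->
  B *m f i = (if (1 < i)%N then (ib i.-1)%:R *: f i.-1 else 0)
             + (ia i)%:R *: f i
             + (if (i < D)%N then (ic i.+1)%:R *: f i.+1 else 0).
Proof.
case/andP=> i1 iD; apply/colP => x; rewrite mxE.
under eq_bigr do rewrite !mxE -natrM mulnb.
rewrite (sum_dvtx (fun z => (e (dvtx x) z && (dist a z == i))%:R)) sum_natb.
have -> : #|[set z | z != a & e (dvtx x) z && (dist a z == i)]| =
          #|[set z | e (dvtx x) z & dist a z == i]|.
  apply: eq_card => z; rewrite !inE andb_idl // => /andP[_ /eqP dz].
  by rewrite eq_sym -(gdist_eq0 (dr_conn hG)) dz -lt0n.
rewrite (card_nbrs_at hG).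
have := gdist_dvtx_gt0 x; have := gdist_dvtx_le x.
rewrite !mxE !(fun_if (fun M : 'cV[R]_#|dvertex a| => M x 0)) !mxE.
move: (dist a (dvtx x)) => j jD j0.
(* each coefficient survives for exactly one value of [j] *)
have -> : (j == i.-1) = (i == j.+1) by lia.
have -> : (j == i.+1) = (i.+1 == j) by lia.
rewrite (eq_sym j i).
case: (eqVneq i j.+1) => [->|_] /=.
  have [-> ->] : (j.+1 == j) = false /\ (j.+2 == j) = false by lia.
  by rewrite ltnS j0 mulr1 !mulr0 if_same !addr0.
rewrite mulr0 if_same add0r.
case: (eqVneq i j) => [->|_].
  have -> : (j.+1 == j) = false by lia.
  by rewrite mulr1 mulr0 if_same addr0.
rewrite mulr0 add0r.
case: (eqVneq i.+1 j) => [<-|_] in jD *; first by rewrite jD mulr1.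
by rewrite mulr0 if_same.
Qed.

Lemma Emx_fvec i : E *m f i = (i == 1%N)%:R *: b.
Proof.
rewrite bvec_fvec /Emx bvec_fvec mul_diag_mx; apply/colP => x; rewrite !mxE.
by rewrite -!natrM !mulnb; case: eqP => [->|_] //=; rewrite eq_sym; case: eqP.
Qed.

Lemma ones_fvec : J = \sum_(i <- iota 1 D) f i.
Proof.
apply/colP => x; rewrite mxE summxE.
rewrite (bigD1_seq (dist a (dvtx x))) ?iota_uniq //=; last first.
  by rewrite mem_iota gdist_dvtx_gt0 add1n ltnS gdist_dvtx_le.
rewrite mxE eqxx big1 ?addr0 // => i.
by rewrite mxE eq_sym => /negPf->.
Qed.

Lemma fvec_neq0 i : (1 <= i <= D)%N -> f i != 0.
Proof.
case/andP=> i1 iD; have [x dx] := sphere_nonempty hG a iD.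
have xa : x != a by rewrite eq_sym -(gdist_eq0 (dr_conn hG)) dx -lt0n.
have [j jx] := dvtx_surj xa; apply: contra_eq_neq (dx) => fi0.
have := congr1 (fun M : 'cV[R]_#|dvertex a| => M j 0) fi0.
by rewrite !mxE jx; case: eqP => // _ /eqP; rewrite oner_eq0.
Qed.

Lemma dotv_fvec i j : i != j -> dotv (f i) (f j) = 0.
Proof.
move=> ij; rewrite dotvE big1 // => x _; rewrite !mxE -natrM mulnb.
by case: eqP => // ->; rewrite (negPf ij).
Qed.

Lemma fvec_orthogonal : orthogonal_family fs.
Proof.
have f0 i : i \in iota 1 D -> f i != 0.
  by rewrite mem_iota add1n ltnS => /fvec_neq0.
split.
- rewrite map_inj_in_uniq ?iota_uniq // => i j Di Dj fij.
  apply: contraTeq (f0 _ Di) => /dotv_fvec/eqP.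
  by rewrite -fij dotvv_eq0 negbK.
- by apply/mapP => -[i /f0 fi /esym/eqP]; rewrite (negPf fi).
- move=> _ _ /mapP[i Di ->] /mapP[j Dj ->] fij.
  by apply: dotv_fvec; apply: contraNneq fij => ->.
Qed.

Lemma fvec_in i : (1 <= i <= D)%N -> f i \in <<fs>>%VS.
Proof.
by move=> iD; apply/memv_span/map_f; rewrite mem_iota add1n ltnS.
Qed.

(** The three-term formula solved for its last term, which is possible because
    [c_(i+1)] is nonzero. *)
Lemma span_fvec_min (U : {vspace 'cV[R]_#|dvertex a|}) :
  f 1 \in U -> {in U, forall v, B *m v \in U} -> (<<fs>> <= U)%VS.
Proof.
move=> Uf1 UB; suff Uf i : (1 <= i <= D)%N -> f i \in U.
  apply/span_subvP => _ /mapP[i Di ->]; apply: Uf.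
  by rewrite mem_iota add1n ltnS in Di.
elim/ltn_ind: i => -[|[|i]] // IHi /andP[_ iD].
have Bf := @Bmx_fvec i.+1 (ltnW iD); rewrite iD in Bf.
have ci0 : (ic i.+2)%:R != 0 :> R.
  by rewrite pnatr_eq0 -lt0n (ic_gt0 hG).
have Ufi : f i.+1 \in U by apply: IHi; rewrite //= ltnW.
have Uprev : (if (1 < i.+1)%N then (ib i)%:R *: f i else 0) \in U.
  case: ifP => [i1|_]; rewrite ?mem0v // memvZ // IHi //.
  by rewrite -ltnS i1 /= ltnW // ltnW.
rewrite -[f i.+2]scale1r -(mulVf ci0) -scalerA memvZ //.
have -> : (ic i.+2)%:R *: f i.+2 =
    B *m f i.+1 - ((if (1 < i.+1)%N then (ib i)%:R *: f i else 0)
                   + (ia i.+1)%:R *: f i.+1).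
  by rewrite Bf /= addrC addKr.
by rewrite memvB ?UB // memvD // memvZ.
Qed.

Lemma Bmx_stable : {in <<fs>>%VS, forall v, B *m v \in <<fs>>%VS}.
Proof.
apply: span_stable => _ /mapP[i + ->]; rewrite mem_iota add1n ltnS => iD.
rewrite Bmx_fvec //; apply: memvD; first apply: memvD.
- by case: ifP => i1; rewrite ?mem0v // memvZ // fvec_in //; lia.
- by rewrite memvZ // fvec_in.
- by case: ifP => i1; rewrite ?mem0v // memvZ // fvec_in.
Qed.

Lemma Emx_stable : {in <<fs>>%VS, forall v, E *m v \in <<fs>>%VS}.
Proof.
apply: span_stable => _ /mapP[i _ ->].
by rewrite Emx_fvec bvec_fvec memvZ // fvec_in.
Qed.

(** Stated for any set of generators between [B] and [B, E], since [P] and [R[B]1]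
    are both instances, and for any vector [v], since [b] has to be recognized as
    cyclic too. *)
Lemma alg_mod_span (s : seq 'M[R]_#|dvertex a|) v :
    B \in s -> {subset s <= [:: B; E]} -> v \in <<fs>>%VS ->
    f 1 \in alg_mod (gen_alg s) v ->
  alg_mod (gen_alg s) v = <<fs>>%VS.
Proof.
move=> sB sBE fsv vf1; apply/eqP; rewrite eqEsubv alg_mod_min //=; last first.
  move=> X /sBE; rewrite !inE => /pred2P[]->; first exact: Bmx_stable.
  exact: Emx_stable.
apply: span_fvec_min => // w vw.
by apply: gen_alg_stable => //; apply: gen_alg_gen.
Qed.

Lemma ones_cyclic (s : seq 'M[R]_#|dvertex a|) :
    B \in s -> {subset s <= [:: B; E]} ->
  alg_mod (gen_alg s) J = <<fs>>%VS.
Proof.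
move=> sB sBE; apply: alg_mod_span => //.
  rewrite ones_fvec big_seq memv_suml // => i.
  by rewrite mem_iota add1n ltnS => /fvec_in.
rewrite -[f 1](subKr (d%:R *: J)) -Bmx_ones memvB ?memvZ ?alg_mod_gen //.
by apply: gen_alg_stable; rewrite ?alg_mod_gen ?gen_alg_gen.
Qed.

Lemma dotv_bvec : dotv b b = d%:R.
Proof.
rewrite dotvE -(dr_val hG a).
under eq_bigr do rewrite !mxE -natrM mulnb andbb.
rewrite (sum_dvtx (fun z => (e a z)%:R)) sum_natb; congr _%:R.
apply: eq_card => z; rewrite !inE; case: eqP => // ->.
by rewrite (dr_irr hG).
Qed.

Lemma Emx_rank1 :
  {in <<fs>>%VS, forall v, E *m v = (d%:R^-1 *: (b *m b^T)) *m v}.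
Proof.
have d0 : d%:R != 0 :> R.
  by rewrite -dotv_bvec dotvv_eq0 bvec_fvec fvec_neq0.
move=> v; rewrite -[LHS](lfunE (mulmx E)) -[RHS](lfunE (mulmx _)).
move: v; apply/span_lfunP => _ /mapP[i _ ->]; rewrite !lfunE /= Emx_fvec.
rewrite -scalemxAl -mulmxA trmx_mul_dotv mul_mx_scalar scalerA.
case: eqP => [->|/eqP i1]; first by rewrite -bvec_fvec dotv_bvec mulVf.
have -> : dotv b (f i) = 0 by rewrite bvec_fvec dotv_fvec // eq_sym.
by rewrite mulr0.
Qed.

(** The rank-one operator required by [restr_alg_full] is [d E]. *)
Lemma restr_Balg_full : restr_alg (Balg R e a) (Pmod R e a) = fullv.
Proof.
have PE : Pmod R e a = <<fs>>%VS by apply: ones_cyclic; rewrite ?mem_head.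
have d0 : d%:R != 0 :> R.
  by rewrite -dotv_bvec dotvv_eq0 bvec_fvec fvec_neq0.
have sT : {in [:: B; E], forall X, X^T = X}.
  move=> X; rewrite !inE => /pred2P[]->; last exact: tr_diag_mx.
  by apply/matrixP => i j; rewrite !mxE (dr_sym hG).
have bP : alg_mod (Balg R e a) b = Pmod R e a.
  rewrite [RHS]PE; apply: alg_mod_span; rewrite ?mem_head //.
    by rewrite bvec_fvec fvec_in.
  by rewrite -bvec_fvec; apply: alg_mod_gen.
have AE : d%:R *: E \in Balg R e a.
  by apply/memvZ/gen_alg_gen; rewrite !inE eqxx orbT.
apply: (restr_alg_full sT bP AE) fvec_orthogonal (PE) => v Pv.
have /Emx_rank1 Ev : v \in <<fs>>%VS by rewrite -PE.
by rewrite -scalemxAl Ev -scalemxAl scalerA mulfV ?scale1r.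
Qed.

End DeletedGraph.

Theorem proposition5p1 (R : realType) (T : finType) (e : rel T)
    (d D : nat) (ib ic ia : nat -> nat)
    (hG : distance_regular e d D ib ic ia) (hD : (1 <= D)%N) (a : T) :
  let B := Bmx R e a in
  let E := Emx R e a in
  let b := bvec R e a in
  let f := fvec R e a in
  let P := Pmod R e a in
  [/\ P = alg_mod (gen_alg [:: B]) (onesv R a),
      P = <<[seq f i | i <- iota 1 D]>>%VS,
      restr_alg (Balg R e a) P = fullv /\ End_iso_mx D P,
      forall i : nat, (1 <= i <= D)%N ->
        B *m f i = (if (1 < i)%N then (ib i.-1)%:R *: f i.-1 else 0)
                   + (ia i)%:R *: f i
                   + (if (i < D)%N then (ic i.+1)%:R *: f i.+1 else 0)
    & forall v, v \in P -> E *m v = (d%:R^-1 *: (b *m b^T)) *m v].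
Proof.
move=> B E b f P.
have PE : P = <<[seq f i | i <- iota 1 D]>>%VS.
  by apply: (ones_cyclic hG hD); rewrite ?mem_head.
split=> //.
- rewrite PE (ones_cyclic hG hD) ?mem_head // => X.
  by rewrite !inE => ->.
- split; first exact: (restr_Balg_full R hG hD).
  apply: End_iso_mx_dim; rewrite PE orthogonal_dim ?size_map ?size_iota //.
  exact: (fvec_orthogonal R hG).
- exact: (Bmx_fvec R hG).
- by rewrite PE; apply: (Emx_rank1 hG hD).
Qed.
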